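(* Let $(\mathbb{X},\|\cdot\|)$ be a real Banach space and let $f:\mathbb{X}\longrightarrow\mathbb{R}$ be lower semicontinuous on $\mathbb{X}$ and bounded from below. Suppose that at each point $x\in\mathbb{X}$ the Hadamard lower derivative $f^{\downarrow}_{\mathcal{H}}(x;\cdot)$ admits a lower exhauster $\mathcal{E}^{\downarrow}_{\mathcal{H}}(f,x)$ and that $$\inf_{x\in\mathbb{X}\backslash\mathrm{Argmin}(f)}\|\mathcal{E}^{\downarrow}_{\mathcal{H}}(f,x)\|=\tau>0.$$ Then $f$ admits global weak sharp minimizers and $\mathrm{wsha}(f)\ge\tau$.
   Context: $\mathbb{X}^*$ is the topological dual of $\mathbb{X}$ with null functional $\mathbf{0}^*$, and $\langle\cdot,\cdot\rangle$ is the duality pairing. In a normed space, $\mathrm{dist}(x,A)=\inf_{a\in A}\|x-a\|$, with $\mathrm{dist}(x,\varnothing)=+\infty$. $\mathcal{K}(\mathbb{X}^* )$ denotes the family of all nonempty, convex, weak* compact subsets of $\mathbb{X}^*$. The Hadamard lower derivative of $f$ at $x$ in the direction $v\in\mathbb{X}$ is $$f^{\downarrow}_{\mathcal{H}}(x;v)=\liminf_{v'\to v,\ t\to0^+}\frac{f(x+tv')-f(x)}{t}.$$ A family $\mathcal{E}\subseteq\mathcal{K}(\mathbb{X}^* )$ is a lower exhauster of a positively homogeneous (of degree one) function $p:\mathbb{X}\to\mathbb{R}\cup\{\pm\infty\}$ if $p(v)=\inf_{E\in\mathcal{E}}\max_{x^*\in E}\langle x^*,v\rangle$ for all $v\in\mathbb{X}$.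 $\mathcal{E}^{\downarrow}_{\mathcal{H}}(f,x)$ denotes a lower exhauster of $f^{\downarrow}_{\mathcal{H}}(x;\cdot)$. For a family $\mathcal{E}\subseteq\mathcal{K}(\mathbb{X}^* )$ put $\|\mathcal{E}\|=\sup_{E\in\mathcal{E}}\mathrm{dist}(\mathbf{0}^*,E)$. Weak sharpness: put $\underline{\alpha}=\inf_{x\in\mathbb{X}}f(x)$ and $\mathrm{Argmin}(f)=\{x\in\mathbb{X}: f(x)\le\underline{\alpha}\}$. The function $f$ admits global weak sharp minimizers if $\mathrm{Argmin}(f)\ne\varnothing$ and there exists $\sigma>0$ such that $\sigma\cdot\mathrm{dist}(x,\mathrm{Argmin}(f))\le f(x)-\underline{\alpha}$ for every $x\in\mathbb{X}$. The supremum of all such $\sigma$ is denoted by $\mathrm{wsha}(f)$. *)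

(* Defs.v *)
From HB Require Import structures.
From mathcomp Require Import all_boot all_order all_algebra.
From mathcomp Require Import all_classical all_reals all_analysis.

Set Implicit Arguments.
Unset Strict Implicit.
Unset Printing Implicit Defensive.

Import Order.TTheory GRing.Theory Num.Theory.
Import numFieldNormedType.Exports.

Local Open Scope classical_set_scope.
Local Open Scope ring_scope.

Section Dual.
Context {R : realType} (X : normedModType R).

Definition is_dual : {pred X -> R} :=
  [pred phi : X -> R | `[< linear phi /\ continuous phi >]].

Lemma is_dualP (phi : X -> R) :
  reflect (linear phi /\ continuous phi) (phi \in is_dual).
Proof. exact: asboolP. Qed.

Lemma is_dual_submod_closed : submod_closed is_dual.
Proof.
split=> [|a phi psi /is_dualP[lphi cphi] /is_dualP[lpsi cpsi]].
  apply/is_dualP; split; last exact: cst_continuous.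
  by move=> a x y; rewrite /GRing.zero /= scaler0 addr0.
apply/is_dualP; split=> [b x y|x].
  rewrite !fctE lphi lpsi !scalerDr !scalerA mulrC -!addrA; congr (_ + _).
  by rewrite addrCA.
by apply: cvgD; [apply: cvgZl_tmp; exact: cphi|exact: cpsi].
Qed.

HB.instance Definition _ :=
  GRing.isSubmodClosed.Build R (X -> R) is_dual is_dual_submod_closed.

Record dual := Dual { dual_val :> X -> R; dual_valP : dual_val \in is_dual }.

HB.instance Definition _ := [isSub for dual_val].
HB.instance Definition _ := gen_eqMixin dual.
HB.instance Definition _ := gen_choiceMixin dual.
HB.instance Definition _ := [SubChoice_isSubLmodule of dual by <:].

Implicit Types phi psi : dual.

Lemma dual_linear phi : linear phi.
Proof. by have [] := is_dualP _ (dual_valP phi). Qed.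

Lemma dual_continuous phi : continuous phi.
Proof. by have [] := is_dualP _ (dual_valP phi). Qed.

HB.instance Definition _ phi :=
  GRing.isLinear.Build R X R *:%R (dual_val phi) (dual_linear phi).

Definition dual_norm phi : R := sup [set `|phi x| | x in [set x | `|x| <= 1]].

Lemma dual_norm_has_sup phi :
  has_sup [set `|phi x| | x in [set x | `|x| <= 1]].
Proof.
split; first by exists `|phi 0|, 0 => //=; rewrite normr0.
have /bounded_funP/(_ 1)[M HM] : bounded_near phi (nbhs 0).
  exact/linear_bounded_continuous/dual_continuous.
by exists M => _ [x /= x1 <-]; exact: HM.
Qed.

Lemma dual_norm_ub phi x : `|x| <= 1 -> `|phi x| <= dual_norm phi.
Proof. by move=> x1; apply: (ub_le_sup (dual_norm_has_sup phi).2); exists x. Qed.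

Lemma dual_norm_le phi r :
  (forall x, `|x| <= 1 -> `|phi x| <= r) -> dual_norm phi <= r.
Proof.
move=> H; apply: ge_sup; first exact: (dual_norm_has_sup phi).1.
by move=> _ [x /= x1 <-]; exact: H.
Qed.

Lemma dual_normD phi psi : dual_norm (phi + psi) <= dual_norm phi + dual_norm psi.
Proof.
apply: dual_norm_le => x x1; apply: le_trans (ler_normD (phi x) (psi x)) _.
by rewrite lerD// dual_norm_ub.
Qed.

Lemma dual_normZ (a : R) phi : dual_norm (a *: phi) = `|a| * dual_norm phi.
Proof.
have le b psi : dual_norm (b *: psi) <= `|b| * dual_norm psi.
  apply: dual_norm_le => x x1; rewrite (_ : dual_val _ x = b * psi x)//.
  by rewrite normrM ler_wpM2l// dual_norm_ub.
apply/eqP; rewrite eq_le le/=; have [->|a0] := eqVneq a 0.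
  rewrite normr0 mul0r; apply: le_trans (dual_norm_ub _ (x := 0) _) => //.
  by rewrite normr0.
rewrite -ler_pdivlMl ?normr_gt0// -normfV.
by rewrite -[in X in X <= _](scale1r phi) -(mulVf a0) -scalerA.
Qed.

Lemma dual_norm_eq0 phi : dual_norm phi = 0 -> phi = 0.
Proof.
move=> phi0; apply/val_inj/funext => x /=; rewrite [RHS](_ : _ = 0)//.
have [->|x0] := eqVneq x 0; first exact: linear0.
have : `|phi (`|x|^-1 *: x)| <= 0.
  rewrite -phi0 dual_norm_ub// normrZ normfV normr_id mulVf//.
  by rewrite normr_eq0.
rewrite normr_le0 linearZ/= mulf_eq0 invr_eq0 normr_eq0 (negbTE x0)/=.
by move/eqP.
Qed.

HB.instance Definition _ :=
  Lmodule_isNormed.Build R dual dual_normD dual_normZ dual_norm_eq0.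

(* [dual] carries the norm topology; [weak_star] is the same type with the
   topology of pointwise convergence on X. *)
Definition weak_star := initial_topology (dual_val : dual -> {ptws X -> R}).
HB.instance Definition _ := Topological.on weak_star.

Lemma weak_star_eval_continuous (v : X) :
  continuous (fun phi : weak_star => (phi : dual) v).
Proof.
move=> phi; apply: (@continuous_comp weak_star {ptws X -> R} R
  dual_val (fun g => g v)); first exact: initial_continuous.
exact: proj_continuous.
Qed.

Definition weak_star_convex_compacts : set (set dual) :=
  [set E : set dual | [/\ E !=set0, convex_set (M := dual) E
             & compact (E : set weak_star)]].

End Dual.
Arguments weak_star_convex_compacts {R} X.

Section Exhausters.
Context {R : realType} {X : normedModType R}.
Local Open Scope ereal_scope.

Definition dist (V : normedModType R) (x : V) (A : set V) : \bar R :=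
  ereal_inf [set `|x - a|%:E | a in A].

Definition hadamard_lower_derivative (f : X -> R) (x v : X) : \bar R :=
  limf_einf (fun p : X * R => ((f (x + p.2 *: p.1)%R - f x) / p.2)%:E)
            (filter_prod (nbhs v) (0 : R)^'+).

(* [max_E <., v>]; the supremum is attained on weak* compact sets, see
   [support_max]. *)
Definition support_function (E : set (dual X)) (v : X) : \bar R :=
  ereal_sup [set (phi v)%:E | phi in E].

Lemma support_max (E : set (dual X)) (v : X) :
  weak_star_convex_compacts X E ->
  exists2 phi, E phi &
    (forall psi, E psi -> (psi v <= phi v)%R) /\ support_function E v = (phi v)%:E.
Proof.
move=> [E0 _ cE].
have [|phi /set_mem Ephi phi_max] :=
    @compact_EVT_max (weak_star X) R (fun phi => (phi : dual X) v) E E0 cE.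
  exact/continuous_subspaceT/weak_star_eval_continuous.
exists phi => //; split=> [psi Epsi|]; first exact/phi_max/mem_set.
apply/eqP; rewrite eq_le; apply/andP; split; last by apply: ereal_sup_ubound; exists phi.
by apply: ge_ereal_sup => _ [psi Epsi <-]; rewrite lee_fin; exact/phi_max/mem_set.
Qed.

Definition lower_exhauster (EE : set (set (dual X))) (p : X -> \bar R) : Prop :=
  EE `<=` weak_star_convex_compacts X /\
  forall v, p v = ereal_inf [set support_function E v | E in EE].

Lemma lower_exhauster_homogeneous EE p : lower_exhauster EE p ->
  forall (t : R) v, (0 < t)%R -> p (t *: v)%R = t%:E * p v.
Proof.
move=> [_ pE] t v t0; rewrite !pE -ereal_inf_pZl//; congr ereal_inf.
rewrite image_comp; congr image; apply/funext => E.
rewrite /= /support_function -ereal_sup_pZl//; congr ereal_sup.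
rewrite image_comp; congr image; apply/funext => phi /=.
by rewrite linearZ/= EFinM.
Qed.

Definition exhauster_norm (EE : set (set (dual X))) : \bar R :=
  ereal_sup [set dist 0%R E | E in EE].

End Exhausters.

Section WeakSharpness.
Context {R : realType} {X : normedModType R}.
Local Open Scope ereal_scope.
Implicit Types f : X -> R.

Definition inf_value f : \bar R := ereal_inf (range (EFin \o f)).

Definition Argmin f : set X := [set x | (f x)%:E <= inf_value f].

Definition weak_sharp_constants f : set R :=
  [set sigma | (0 < sigma)%R /\
     forall x, sigma%:E * dist x (Argmin f) <= (f x)%:E - inf_value f].

Definition global_weak_sharp_minimizers f : Prop :=
  Argmin f !=set0 /\ weak_sharp_constants f !=set0.

Definition wsha f : \bar R := ereal_sup (EFin @` weak_sharp_constants f).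

End WeakSharpness.

(* Main.v *)
Require Import Defs.
From HB Require Import structures.
From mathcomp Require Import all_boot all_order all_algebra.
From mathcomp Require Import all_classical all_reals all_analysis.
From mathcomp Require Import ring lra.

Set Implicit Arguments.
Unset Strict Implicit.
Unset Printing Implicit Defensive.

Import Order.TTheory GRing.Theory Num.Theory.
Import numFieldNormedType.Exports.

Local Open Scope classical_set_scope.
Local Open Scope ring_scope.

(** Fix a real [s] with [0 < s < tau]. Ekeland's variational principle
    ([ekeland_variational_principle]) leads from any [x] to a point [y] with
    [f y + s * `|x - y| <= f x] at which [f] decreases with slope at most [s] in
    every direction. If [y] were not a minimizer, the exhauster of the Hadamard
    lower derivative at [y] would have norm at least [tau > s], so one of its
    members [E] would lie at distance more than [s] from 0. Separating [E] from
    the dual ball of radius [s] ([weak_star_separation]) gives a direction [v] in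
    the unit ball of [X] along which the support function of [E], hence the
    derivative of [f], is below [- s]: too steep for [y]
    ([exhauster_norm_le]). So [y] is a minimizer, and
    [s * `|x - y| <= f x - f y] is the weak sharpness inequality with constant
    [s] at [x]. In particular minimizers exist, and letting [s] increase to
    [tau] gives the bound on the modulus.

    The separating direction must come from [X] and not from its bidual, which
    is where weak* compactness is used: it reduces the question to finitely many
    vectors of [X], and for those a minimax argument ([finite_minimax]) follows
    by induction from an elementary alternative for two affine functions
    ([affine_alternative]). *)

(** * Ekeland's variational principle *)

(** Ekeland's variational principle. Write [below y z] for
    [f z + sigma * `|y - z| <= f y], a partial order. The sequence [u] moves each
    time to a point below whose value is at most halfway to the infimum of [f]
    over all points below; along it [sigma] times the distance is controlled by
    the decrease of [f], so it is Cauchy. Its limit [y] is below every [u n] by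
    lower semicontinuity, and the halving forces any point below [y] to have
    value at least [lim f (u n)], hence to be [y] itself. *)
Lemma ekeland_variational_principle (R : realType) (X : completeNormedModType R)
    (f : X -> R) (sigma : R) (x : X) :
  0 < sigma -> lower_semicontinuous (EFin \o f) -> has_lbound (range f) ->
  exists2 y, f y + sigma * `|x - y| <= f x &
    forall z, z != y -> f y < f z + sigma * `|z - y|.
Proof.
move=> sigma0 flsc [b fb].
have fge z : b <= f z by apply: fb; exists z.
pose below y z := f z + sigma * `|y - z| <= f y.
have below_trans y z w : below y z -> below z w -> below y w.
  rewrite /below => yz zw.
  have := ler_wpM2l (ltW sigma0) (ler_distD z y w); lra.
have below_refl y : below y y by rewrite /below subrr normr0 mulr0 addr0.
have step y : {y' | below y y' /\ forall z, below y z -> 2 * f y' <= f y + f z}.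
  (* The claim is the halving step, freed of the infimum. *)
  apply/cid; set m := inf [set f z | z in below y].
  have inf_m : has_inf [set f z | z in below y].
    by split; [exists (f y), y|exists b => _ [z _ <-]].
  have mle z : below y z -> m <= f z.
    by move=> yz; apply: (ge_inf inf_m.2); exists z.
  have [fym|mfy] := leP (f y) m.
    by exists y; split=> // z /mle; lra.
  have e0 : 0 < (f y - m) / 2 by lra.
  have [_ [y' yy' <-] y'lt] := inf_adherent e0 inf_m.
  by exists y'; split=> // z /mle; rewrite -/m in y'lt; lra.
have [u [u0 uS]] := dependent_choice step x.
have ub n m : (n <= m)%N -> below (u n) (u m).
  elim: m => [|m IH]; first by rewrite leqn0 => /eqP->.
  rewrite leq_eqVlt => /predU1P[->//|/IH unm].
  exact: below_trans unm (uS m).1.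
set l := inf (range (f \o u)).
have inf_l : has_inf (range (f \o u)).
  by split; [exists (f (u 0%N)), 0%N|exists b => _ [n _ <-]; exact: fge].
have lle n : l <= f (u n) by apply: (ge_inf inf_l.2); exists n.
have ult e : 0 < e -> exists n, f (u n) < l + e.
  by move=> e0; have [_ [n _ <-]] := inf_adherent e0 inf_l; exists n.
have /cauchy_cvg/cvg_ex[y uy] : cauchy (u @ \oo).
  apply: cauchy_exP => e e0; have [n un] := ult _ (mulr_gt0 sigma0 e0).
  exists (u n), n => // m /= /ub; rewrite /below -ball_normE /= => unm.
  by rewrite -(ltr_pM2l sigma0); have := lle m; lra.
have uby n : below (u n) y.
  rewrite /below leNgt; apply/negP => ylt.
  (* [d] is the amount by which the limit violates [below (u n)]; half of it is
     spent on lower semicontinuity, half on the distance from [u k] to [y]. *)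
  set d := f y + sigma * `|u n - y| - f (u n).
  have d0 : 0 < d by rewrite /d; lra.
  have [|V Vy fV] := flsc y (f y - d / 2); first by rewrite lte_fin; lra.
  have e0 : 0 < d / 2 / sigma by rewrite !divr_gt0.
  have : \forall k \near \oo,
      [/\ (n <= k)%N, V (u k) & `|y - u k| < d / 2 / sigma].
    near=> k; split; near: k; first exact: nbhs_infty_ge.
      exact: uy.
    by move/cvgrPdist_lt : uy; apply.
  case=> k _ /(_ _ (leqnn k))[/ub unk /fV]; rewrite lte_fin => fuk.
  rewrite ltr_pdivlMr// mulrC => yuk.
  have := ler_wpM2l (ltW sigma0) (ler_distD (u k) (u n) y).
  by move: unk; rewrite /below (distrC (u k)) /d in fuk yuk *; lra.
have yl : f y <= l.
  apply: lb_le_inf; first by exists (f (u 0%N)), 0%N.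
  move=> _ [n _ <-] /=; have := uby n; rewrite /below.
  by have := mulr_ge0 (ltW sigma0) (normr_ge0 (u n - y)); lra.
exists y; first by have := uby 0%N; rewrite u0.
move=> z zy; rewrite ltNge; apply/negP => yz.
have lz : l <= f z.
  rewrite leNgt; apply/negP => zl.
  have [|n un] := ult (l - f z); first by rewrite subr_gt0.
  have /(uS n).2 : below (u n) z.
    by apply: below_trans (uby n) _; rewrite /below distrC.
  by have := lle n.+1; lra.
have : 0 < sigma * `|z - y| by rewrite mulr_gt0// normr_gt0 subr_eq0.
lra.
Unshelve. all: by end_near. Qed.

(** * Separation of weak* compact convex sets *)

Lemma convex_set_comb (R : realType) (M : lmodType R) (K : set M) (t : R)
    (x y : M) : convex_set (M := M) K -> 0 <= t <= 1 ->
  K x -> K y -> K (t *: x + (1 - t) *: y).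
Proof.
move=> cK /andP[t0 t1] Kx Ky.
exact: set_mem (cK x y (Itv01 t0 t1) (mem_set Kx) (mem_set Ky)).
Qed.

(** A theorem of the alternative. A weight [l] must satisfy one upper bound for
    each [x] with [a x <= 0], namely [b x / (b x - a x)], and one lower bound
    for each [y] with [b y <= 0], namely [- b y / (a y - b y)]. Every lower
    bound is below every upper bound ([cross]): otherwise the point of the
    segment from [x] to [y] where [a] vanishes would have [b <= 0]. So the
    supremum of the lower bounds is a valid weight. The bounds may be
    approached, so strictness is lost. *)
Lemma affine_alternative (R : realType) (M : lmodType R) (K : set M)
    (a b : M -> R) :
  convex_set (M := M) K ->
  (forall t x y, a (t *: x + (1 - t) *: y) = t * a x + (1 - t) * a y) ->
  (forall t x y, b (t *: x + (1 - t) *: y) = t * b x + (1 - t) * b y) ->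
  (forall x, K x -> 0 < a x \/ 0 < b x) ->
  exists2 l, 0 <= l <= 1 & forall x, K x -> 0 <= l * a x + (1 - l) * b x.
Proof.
move=> Kc ac bc ab.
have cross x y : K x -> K y -> a x <= 0 -> b y <= 0 -> b y * a x <= b x * a y.
  move=> Kx Ky ax by0; rewrite leNgt; apply/negP => lt.
  have bx : 0 < b x by case: (ab _ Kx) => //; lra.
  have ay : 0 < a y by case: (ab _ Ky) => //; lra.
  have D : 0 < a y - a x by lra.
  have t01 : 0 <= a y / (a y - a x) <= 1.
    by rewrite ler_pdivrMr// divr_ge0//=; lra.
  have := ab _ (convex_set_comb Kc t01 Kx Ky); rewrite ac bc.
  have -> : 1 - a y / (a y - a x) = - a x / (a y - a x) by field; lra.
  have -> : a y / (a y - a x) * a x + - a x / (a y - a x) * a y = 0.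
    by field; lra.
  have -> : a y / (a y - a x) * b x + - a x / (a y - a x) * b y =
    (b x * a y - b y * a x) / (a y - a x) by field; lra.
  by case; rewrite ?ltxx// ltr_pdivlMr//; lra.
(* The extra element 0 keeps [S] inhabited and makes the weight nonnegative. *)
pose S : set R :=
  [set 0] `|` [set - b y / (a y - b y) | y in [set y | K y /\ b y <= 0]].
have S0 : S 0 by left.
have Sub x : K x -> a x <= 0 -> ubound S (b x / (b x - a x)).
  move=> Kx ax; have bx : 0 < b x by case: (ab _ Kx) => //; lra.
  move=> _ [->|[y [Ky by0] <-]]; first by rewrite divr_ge0//; lra.
  have ay : 0 < a y by case: (ab _ Ky) => //; lra.
  rewrite ler_pdivrMr; last lra.
  rewrite mulrAC ler_pdivlMr; last lra.
  have := cross _ _ Kx Ky ax by0; lra.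
have S1 : ubound S 1.
  move=> _ [->|[y [Ky by0] <-]]; first lra.
  have ay : 0 < a y by case: (ab _ Ky) => //; lra.
  by rewrite ler_pdivrMr; lra.
have hS : has_sup S by split; [exists 0|exists 1].
have l0 : 0 <= sup S by exact: (ub_le_sup hS.2).
have l1 : sup S <= 1 by apply: ge_sup => //; exists 0.
exists (sup S); first by rewrite l0.
move=> x Kx; have [ax|ax] := leP (a x) 0.
  have bx : 0 < b x by case: (ab _ Kx) => //; lra.
  have : sup S <= b x / (b x - a x) by apply: ge_sup; [exists 0|exact: Sub].
  by rewrite ler_pdivlMr; lra.
have [bx|bx] := leP (b x) 0.
  have : - b x / (a x - b x) <= sup S.
    by apply: ub_le_sup; [exists 1|right; exists x].
  by rewrite ler_pdivrMr; lra.
have := mulr_ge0 l0 (ltW ax).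
have : 0 <= (1 - sup S) * b x by rewrite mulr_ge0//; lra.
lra.
Qed.

Section Separation.
Context {R : realType} {X : normedModType R}.
Implicit Types (E : set (dual X)) (v w : X).

Lemma dualDx (phi psi : dual X) v : (phi + psi) v = phi v + psi v.
Proof. by []. Qed.

Lemma dualZx (t : R) (phi : dual X) v : (t *: phi) v = t * phi v.
Proof. by []. Qed.

(** A finite form of the minimax theorem: if at every functional of a convex set
    one of finitely many vectors takes a value above [s], then a single convex
    combination of them takes values above [r] on the whole set. The induction
    treats the functionals with [phi v <= s] by the other vectors, which gives a
    vector [w], and merges [v] and [w] by [affine_alternative]. Each merge loses
    strictness, which the margin between [r] and [s] absorbs. *)
Lemma finite_minimax (s : R) (vs : seq X) E : convex_set (M := dual X) E ->
  (forall v, v \in vs -> `|v| <= 1) ->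
  (forall phi, E phi -> exists2 v, v \in vs & s < phi v) ->
  forall r, r < s -> exists2 w, `|w| <= 1 & forall phi, E phi -> r < phi w.
Proof.
elim: vs s E => [|v vs IH] s E cE v1 Es r rs.
  by exists 0 => [|phi /Es[]//]; rewrite normr0.
pose m := (r + s) / 2.
have cEv : convex_set (M := dual X) (E `&` [set phi : dual X | phi v <= s]).
  move=> phi psi t /set_mem[Ephi /= phiv] /set_mem[Epsi /= psiv]; apply/mem_set.
  split; first by apply/set_mem/cE; exact/mem_set.
  have t0 : 0 <= t%:num by [].
  have t1 : t%:num <= 1 by [].
  change (t%:num * phi v + (1 - t%:num) * psi v <= s); nra.
have vs1 u : u \in vs -> `|u| <= 1.
  by move=> uvs; apply: v1; rewrite inE uvs orbT.
have Evs phi : (E `&` [set phi : dual X | phi v <= s]) phi ->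
    exists2 u, u \in vs & s < phi u.
  move=> [/Es[u]]; rewrite inE => /predU1P[->|uvs] su /= phiv; first lra.
  by exists u.
have ms : m < s by rewrite /m; lra.
have [w w1 Ew] := IH s _ cEv vs1 Evs m ms.
have [|||t /andP[t0 t1] Et] := affine_alternative
    (a := fun phi : dual X => phi v - m)
    (b := fun phi : dual X => phi w - m) cE.
- by move=> t phi psi; rewrite dualDx !dualZx; ring.
- by move=> t phi psi; rewrite dualDx !dualZx; ring.
- move=> phi Ephi; have [phiv|phiv] := leP (phi v) s.
    by right; rewrite subr_gt0; exact: Ew.
  by left; rewrite /m; lra.
exists (t *: v + (1 - t) *: w) => [|phi /Et].
  rewrite (le_trans (ler_normD _ _))// !normrZ (ger0_norm t0).
  rewrite ger0_norm ?subr_ge0//.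
  have := ler_wpM2l t0 (v1 v (mem_head _ _)).
  have : (1 - t) * `|w| <= (1 - t) * 1 by rewrite ler_wpM2l// subr_ge0.
  lra.
by rewrite linearD !linearZ /= /GRing.scale /= /m; lra.
Qed.

Lemma dual_norm_gt (s : R) (phi : dual X) :
  s < `|phi| -> exists2 v, `|v| <= 1 & s < phi v.
Proof.
move=> sphi.
have e0 : 0 < dual_norm phi - s by rewrite subr_gt0.
have [_ [v /= v1 <-]] := sup_adherent e0 (dual_norm_has_sup phi).
rewrite -/(dual_norm phi) subKr => sv.
have [phiv|phiv] := leP 0 (phi v).
  by exists v; rewrite // -(ger0_norm phiv).
by exists (- v); rewrite ?normrN// linearN -(ltr0_norm phiv).
Qed.

(* [compact_cover] is about pointed topological spaces. *)
HB.instance Definition _ := isPointed.Build (weak_star X) (0 : dual X).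

Lemma weak_star_compact_subcover (s : R) E (B : set X) :
  compact (E : set (weak_star X)) ->
  (forall phi, E phi -> exists2 v, B v & s < phi v) ->
  exists2 vs : seq X, (forall v, v \in vs -> B v) &
    forall phi, E phi -> exists2 v, v \in vs & s < phi v.
Proof.
move=> cE EB; move: cE; rewrite compact_cover.
move=> /(_ X B (fun v => [set phi : weak_star X | s < (phi : dual X) v])).
case=> [v _||D DB Dcov].
- apply: (@open_comp (weak_star X) R (fun phi => (phi : dual X) v)
      [set x | s < x]).
    by move=> phi _; exact: weak_star_eval_continuous.
  exact: open_gt.
- by move=> phi /EB[v Bv sv]; exists v.
exists (finmap.enum_fset D) => [v /DB/set_mem//|phi Ephi].
by have [v vD sv] := Dcov _ Ephi; exists v.
Qed.

(** Hahn-Banach separation of a weak* compact convex set from a dual ball, with a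
    separating functional in [X] rather than in the bidual. Its opposite
    comes from [finite_minimax] applied to a finite subcover of the open cover
    of [E] by the sets where some vector of the unit ball takes a value above
    [r]. The level [r] lies strictly between [s] and the distance to have room
    on both sides: every norm on [E] exceeds [r], and the minimax step descends
    from [r] to [s]. *)
Lemma weak_star_separation (s : R) E : weak_star_convex_compacts X E ->
  (s%:E < dist 0%R E)%E ->
  exists2 v, `|v| <= 1 & (support_function E v < (- s)%:E)%E.
Proof.
move=> EK sE; have [E0 cE kE] := EK.
have [r sr rE] : exists2 r, s < r & forall phi, E phi -> r < `|phi|.
  have dE phi : E phi -> (dist 0%R E <= `|phi|%:E)%E.
    move=> Ephi; apply: ereal_inf_lbound.
    by exists phi; rewrite // sub0r normrN.
  have [phi0 Ephi0] := E0.
  have : dist 0 E \is a fin_num.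
    rewrite fin_real// (lt_trans (ltNyr _) sE).
    by rewrite (le_lt_trans (dE _ Ephi0))// ltry.
  move=> /fineK dEE; rewrite -dEE lte_fin in sE.
  exists ((s + fine (dist 0 E)) / 2); first lra.
  by move=> phi /dE; rewrite -dEE lee_fin; lra.
have [vs vs1 Evs] := weak_star_compact_subcover (B := [set v | `|v| <= 1]) kE
  (fun phi Ephi => dual_norm_gt (rE phi Ephi)).
have [w w1 Ew] := finite_minimax cE vs1 Evs sr.
exists (- w); first by rewrite normrN.
have [phi Ephi [_ ->]] := support_max (- w) EK.
by rewrite lte_fin linearN ltrN2; exact: Ew.
Qed.

End Separation.

(** * Lower derivatives at points of bounded slope *)

(** Near the direction [v] the difference quotients of [f] at [y] along [v'] are
    at least [- (sigma * `|v'|)], and [v'] tends to [v]. *)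
Lemma hadamard_lower_derivative_ge (R : realType) (X : normedModType R)
    (f : X -> R) (sigma : R) (y v : X) : 0 <= sigma ->
  (forall z, f y <= f z + sigma * `|z - y|) ->
  ((- (sigma * `|v|))%:E <= hadamard_lower_derivative f y v)%E.
Proof.
move=> sigma0 fy; apply/lee_subgt0Pr => e e0.
rewrite /hadamard_lower_derivative limf_einfE.
(* The denominator [sigma + 1] avoids the case [sigma = 0]. *)
have d0 : 0 < e / (sigma + 1) by rewrite divr_gt0//; lra.
pose A := [set v' : X | `|v - v'| < e / (sigma + 1)].
have nA : nbhs v A by have := nbhsx_ballx v _ d0; rewrite -ball_normE.
apply: le_ereal_sup_tmp; eexists.
  exists (A `*` [set t | 0 < t]); last reflexivity.
  by exists (A, [set t | 0 < t]) => //; split => //; exact: nbhs_right_gt.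
apply: le_ereal_inf_tmp => _ [[w t] [/= Aw t0] <-] /=.
rewrite -EFinB lee_fin ler_pdivlMr//.
have := fy (y + t *: w).
rewrite (addrAC y) subrr add0r normrZ (gtr0_norm t0) => fw.
have eE : sigma * (e / (sigma + 1)) <= e.
  by rewrite mulrCA ler_piMr ?(ltW e0)// ler_pdivrMr; lra.
have wv : `|w| <= `|v| + e / (sigma + 1).
  have := lerB_dist w v; move: Aw; rewrite /A /= (distrC v); lra.
have := ler_wpM2l sigma0 wv; nra.
Qed.

(** A member [E] of the exhauster at distance more than [sigma] from 0 would be
    separated from the ball of radius [sigma] by some [v] in the unit ball, and
    the derivative in the direction [v], being at most the support function of
    [E], would drop below [- sigma], which the slope bound at [y] forbids. *)
Lemma exhauster_norm_le (R : realType) (X : normedModType R) (f : X -> R)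
    (EE : set (set (dual X))) (sigma : R) (y : X) : 0 < sigma ->
  lower_exhauster EE (hadamard_lower_derivative f y) ->
  (forall z, f y <= f z + sigma * `|z - y|) ->
  (exhauster_norm EE <= sigma%:E)%E.
Proof.
move=> sigma0 [EEK EEp] fy; rewrite leNgt; apply/negP.
move=> /ereal_sup_gt[_ [E EEE <-]] sE.
have [v v1 vE] := weak_star_separation (EEK _ EEE) sE.
have := hadamard_lower_derivative_ge v (ltW sigma0) fy.
rewrite leNgt => /negP; apply.
rewrite EEp; apply: (@le_lt_trans _ _ (support_function E v)).
  by apply: ereal_inf_lbound; exists E.
apply: (lt_le_trans vE); rewrite lee_fin lerN2.
by rewrite ler_piMr// ltW.
Qed.

(** * Weak sharp minimizers *)

Theorem theorem4p6 (R : realType) (X : completeNormedModType R) (f : X -> R)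
    (f_lsc : lower_semicontinuous (EFin \o f))
    (f_bounded_below : has_lbound (range f))
    (EE : X -> set (set (dual X)))
    (EE_exhauster : forall x : X,
       lower_exhauster (EE x) (hadamard_lower_derivative f x))
    (tau : \bar R)
    (tau_def : ereal_inf [set exhauster_norm (EE x) | x in ~` Argmin f] = tau)
    (tau_gt0 : (0 < tau)%E) :
  global_weak_sharp_minimizers f /\ (tau <= wsha f)%E.
Proof.
(* For [s < tau], Ekeland's principle from [x] ends at a minimizer: elsewhere the
   exhauster norm is at least [tau]. *)
have near_min (s : R) x : 0 < s -> (s%:E < tau)%E ->
    exists2 y, Argmin f y & f y + s * `|x - y| <= f x.
  move=> s0 stau.
  have [y yx ymin] := ekeland_variational_principle x s0 f_lsc f_bounded_below.
  exists y => //; apply: contrapT => yA.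
  have : (tau <= exhauster_norm (EE y))%E.
    by rewrite -tau_def; apply: ereal_inf_lbound; exists y.
  apply/negP; rewrite -ltNge; apply: le_lt_trans stau.
  apply: (exhauster_norm_le s0 (EE_exhauster y)) => z.
  have [->|/ymin/ltW//] := eqVneq z y.
  by rewrite subrr normr0 mulr0 addr0.
have sharp (s : R) : 0 < s -> (s%:E < tau)%E -> weak_sharp_constants f s.
  move=> s0 stau; split=> // x; have [y yA yx] := near_min s x s0 stau.
  have -> : inf_value f = (f y)%:E.
    by apply/eqP; rewrite eq_le yA andbT; apply: ereal_inf_lbound; exists y.
  apply: (@le_trans _ _ (s%:E * `|x - y|%:E)%E).
    by rewrite lee_pmul2l//; apply: ereal_inf_lbound; exists y.
  by rewrite -EFinM -EFinB lee_fin; lra.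
have [s s0 stau] : exists2 s : R, 0 < s & (s%:E < tau)%E.
  move: tau_gt0; case: (tau) => [r|_|//]; last by exists 1; rewrite ?ltry.
  by rewrite lte_fin => r0; exists (r / 2); rewrite ?lte_fin; lra.
split.
  split; last by exists s; exact: sharp.
  by have [y yA _] := near_min s 0 s0 stau; exists y.
rewrite leNgt; apply/negP => wtau.
have wsha_ge r : 0 < r -> (r%:E < tau)%E -> (r%:E <= wsha f)%E.
  by move=> r0 rtau; apply: ereal_sup_ubound; exists r => //; exact: sharp.
have sw := wsha_ge s s0 stau.
move: wtau wsha_ge sw; case: (wsha f) => [w||//] wtau wsha_ge sw.
  2: by rewrite ltNge leey in wtau.
rewrite lee_fin in sw.
have [r wr rtau] : exists2 r : R, w < r & (r%:E < tau)%E.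
  case: (tau) wtau => [t|_|//]; last by exists (w + 1); rewrite ?ltry//; lra.
  by rewrite lte_fin => wt; exists ((w + t) / 2); rewrite ?lte_fin; lra.
have := wsha_ge r (lt_trans s0 (le_lt_trans sw wr)) rtau.
by rewrite lee_fin leNgt wr.
Qed.
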